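(* Let $K$ be a field of characteristic $0$, $\theta=t\frac{d}{dt}$, $g'=\theta g$, and let $\mathcal{L}=\theta^n+\sum_{i=0}^{n-1}a_i\theta^i\in K(t)[\theta]$ be Calabi-Yau, with $\beta$-factor $\beta\in1+tK[[t]]$. Let $\Lambda_{\mathcal{L}}=K[[t]][\theta]/K[[t]][\theta]\mathcal{L}$ with generator $\eta$, $\eta^{(r)}=\theta^r\eta$, and $\operatorname{Fil}^i\subset\Lambda_{\mathcal{L}}$ the $K[[t]]$-span of $\eta^{(j)}$, $0\le j\le n-1-i$ (so $\operatorname{Fil}^{n}=0$). Then there exists a unique increasing filtration $(U_i)_{0\le i\le n-1}$ of $\Lambda_{\mathcal{L}}$ by $K[[t]][\theta]$-submodules such that for all $i$, $\Lambda_{\mathcal{L}}=U_i\oplus\operatorname{Fil}^{i+1}$ and $U_{i+1}/U_i$ are trivial $K[[t]][\theta]$-modules. Moreover, up to multiplication by constants, there is a unique sequence $u_0,\dots,u_{n-1}$ such that (i) $U_i$ is generated as a $K[[t]]$-module by $u_0,\dots,u_i$; (ii) $u_i=\sum_{r=0}^{n-1-i}v_{i,r}\eta^{(r)}$ with $v_{i,n-1-i}=\beta\,wr_i/wr_{i-1}$. Consequently $u_{i+1}'=\tau_{i+1}u_i$ with $\tau_{i+1}=wr_{i-1}wr_{i+1}/wr_i^2$, and in particular $\tau_1=(\log q)'$.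
   Context: $\mathcal{L}$ satisfies condition (N) if $a_i\in K(t)\cap K[[t]]$ and $a_i(0)=0$ for all $i$ (indicial polynomial $s^n$ at $0$). A $\beta$-factor is a non-zero solution of $n\beta'=2a_{n-1}\beta$ (it can be taken in $1+tK[[t]]$ under (N)). The formal adjoint is $\mathcal{L}^*=(-1)^n\theta^n+\sum_i(-1)^i\theta^ia_i$; $\mathcal{L}$ is self-adjoint if $\mathcal{L}^*=(-1)^n\beta\mathcal{L}\beta^{-1}$. $\mathcal{L}$ is Calabi-Yau if it is self-adjoint and satisfies (N). $F=F_0\in1+tK[[t]]$ is the unique power-series solution of $\mathcal{L}F=0$ with constant term $1$; for $1\le i\le n-1$, $F_i$ are solutions of $\mathcal{L}$ with $\sum_{r=0}^i(-1)^rF_{i-r}\frac{\log^r t}{r!}\in K[[t]]$ (the Frobenius basis at $0$). $wr_i=\det(F_r^{(s)})_{0\le r,s\le i}$ is the Wronskian of $F_0,\dots,F_i$ with respect to $\theta$, with $wr_{-1}:=1$. The $q$-coordinate is $q=\exp(F_1/F)$. *)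

(* Defs.v *)
From HB Require Import structures.
From mathcomp Require Import all_boot all_order all_algebra.
From mathcomp Require Import boolp.

Set Implicit Arguments.
Unset Strict Implicit.
Unset Printing Implicit Defensive.

Import GRing.Theory.
Local Open Scope ring_scope.

Section FPS.
Variable K : fieldType.

Record fps := FPS { fcoef : nat -> K }.

HB.instance Definition _ := gen_eqMixin fps.
HB.instance Definition _ := gen_choiceMixin fps.

Lemma fpsP (f g : fps) : (forall k, fcoef f k = fcoef g k) -> f = g.
Proof. by case: f => f; case: g => g /= H; congr FPS; apply/funext. Qed.

Definition fps0 := FPS (fun _ => 0).
Definition fpsopp f := FPS (fun k => - fcoef f k).
Definition fpsadd f g := FPS (fun k => fcoef f k + fcoef g k).

Lemma fpsaddA : associative fpsadd.
Proof. by move=> f g h; apply: fpsP => k /=; rewrite addrA. Qed.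
Lemma fpsaddC : commutative fpsadd.
Proof. by move=> f g; apply: fpsP => k /=; rewrite addrC. Qed.
Lemma fpsadd0 : left_id fps0 fpsadd.
Proof. by move=> f; apply: fpsP => k /=; rewrite add0r. Qed.
Lemma fpsaddN : left_inverse fps0 fpsopp fpsadd.
Proof. by move=> f; apply: fpsP => k /=; rewrite addNr. Qed.

HB.instance Definition _ :=
  GRing.isZmodule.Build fps fpsaddA fpsaddC fpsadd0 fpsaddN.

Definition fps1 := FPS (fun k => (k == 0%N)%:R).
Definition fpsmul f g :=
  FPS (fun k => \sum_(i < k.+1) fcoef f i * fcoef g (k - i)).

Definition ftrunc (k : nat) (f : fps) : {poly K} := \poly_(i < k.+1) fcoef f i.

Lemma ftruncE j k f : (j <= k)%N -> (ftrunc k f)`_j = fcoef f j.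
Proof. by move=> H; rewrite /ftrunc coef_poly ltnS H. Qed.

Lemma mul_agree (p q : {poly K}) f g i :
  (forall j, (j <= i)%N -> p`_j = fcoef f j) ->
  (forall j, (j <= i)%N -> q`_j = fcoef g j) ->
  (p * q)`_i = fcoef (fpsmul f g) i.
Proof.
move=> Hp Hq; rewrite coefM /=; apply: eq_bigr => j _.
by rewrite Hp ?Hq // ?leq_subr // -ltnS.
Qed.

Lemma fpsmulA : associative fpsmul.
Proof.
move=> f g h; apply: fpsP => k.
rewrite -(@mul_agree (ftrunc k f) (ftrunc k g * ftrunc k h)); last 2 first.
- by move=> j Hj; rewrite ftruncE.
- move=> j Hj; apply: mul_agree => l Hl; rewrite ftruncE //; exact: leq_trans Hj.
rewrite -(@mul_agree (ftrunc k f * ftrunc k g) (ftrunc k h)); last 2 first.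
- move=> j Hj; apply: mul_agree => l Hl; rewrite ftruncE //; exact: leq_trans Hj.
- by move=> j Hj; rewrite ftruncE.
by rewrite mulrA.
Qed.

Lemma fpsmulC : commutative fpsmul.
Proof.
move=> f g; apply: fpsP => k /=.
rewrite [RHS](reindex_inj rev_ord_inj) /=; apply: eq_bigr => i _.
rewrite subSS subKn; first by rewrite mulrC.
by rewrite -ltnS.
Qed.

Lemma fpsmul1 : left_id fps1 fpsmul.
Proof.
move=> f; apply: fpsP => k /=.
rewrite big_ord_recl /= mul1r subn0 big1 ?addr0 // => i _.
by rewrite mul0r.
Qed.

Lemma fpsmulDl : left_distributive fpsmul fpsadd.
Proof.
move=> f g h; apply: fpsP => k /=.
by rewrite -big_split /=; apply: eq_bigr => i _; rewrite mulrDl.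
Qed.

Lemma fps1_neq0 : fps1 != 0.
Proof.
apply/eqP => H; have := congr1 (fun f => fcoef f 0) H => /=.
by move/eqP; rewrite oner_eq0.
Qed.

HB.instance Definition _ :=
  GRing.Zmodule_isComNzRing.Build fps fpsmulA fpsmulC fpsmul1 fpsmulDl fps1_neq0.

Definition fpsunit : {pred fps} := fun f => `[< exists g : fps, g * f = 1 >].
Definition fpsinv (f : fps) : fps :=
  match pselect (exists g : fps, g * f = 1) with
  | left H => projT1 (cid H)
  | right _ => f
  end.

Lemma fpsmulV : {in fpsunit, left_inverse 1 fpsinv *%R}.
Proof.
move=> f Hf; rewrite /fpsinv; case: pselect => [H|nH]; first exact: projT2 (cid H).
by exfalso; apply: nH; apply/asboolP.
Qed.

Lemma fpsunitPl (f g : fps) : g * f = 1 -> fpsunit f.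
Proof. by move=> H; apply/asboolP; exists g. Qed.

Lemma fpsinv_out : {in [predC fpsunit], fpsinv =1 id}.
Proof.
move=> f; rewrite inE => /negP Hf; rewrite /fpsinv; case: pselect => // H.
by exfalso; apply: Hf; apply/asboolP.
Qed.

HB.instance Definition _ :=
  GRing.ComNzRing_hasMulInverse.Build fps fpsmulV fpsunitPl fpsinv_out.

Definition fps_theta (f : fps) : fps := FPS (fun k => k%:R * fcoef f k).

Definition cst (c : K) : fps := FPS (fun k => if k == 0%N then c else 0).
Definition fps_of_poly (p : {poly K}) : fps := FPS (fun k => p`_k).

Definition rational_fps (f : fps) : Prop :=
  exists p q : {poly K}, q != 0 /\ fps_of_poly q * f = fps_of_poly p.

End FPS.

Arguments fps : clear implicits.

(* Quotient in a commutative ring: x / y when y divides x (chosen classically, *)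
(* unique in an integral domain), 0 otherwise.                               *)
Definition qdiv (R : comNzRingType) (x y : R) : R :=
  match pselect (exists z : R, z * y = x) with
  | left H => projT1 (cid H)
  | right _ => 0
  end.

Section Operator.
Variables (K : fieldType) (n : nat) (a : nat -> fps K).

Definition Lfps (f : fps K) : fps K :=
  iter n (@fps_theta K) f + \sum_(i < n) a i * iter i (@fps_theta K) f.

Definition Lstar (f : fps K) : fps K :=
  (-1) ^+ n * iter n (@fps_theta K) f
  + \sum_(i < n) (-1) ^+ i * iter i (@fps_theta K) (a i * f).

Definition condN : Prop :=
  forall i, (i < n)%N -> rational_fps (a i) /\ fcoef (a i) 0 = 0.

Definition beta_factor (beta : fps K) : Prop :=
  beta != 0 /\ n%:R * fps_theta beta = 2%:R * a n.-1 * beta.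

Definition self_adjoint (beta : fps K) : Prop :=
  forall f : fps K, Lstar f = (-1) ^+ n * beta * Lfps (beta^-1 * f).

Definition calabi_yau (beta : fps K) : Prop :=
  condN /\ beta_factor beta /\ self_adjoint beta.

(* Logarithmic solutions: K[[t]][log t] is modelled as {poly fps K}, the     *)
(* variable 'X standing for log t; theta acts by theta(t) coefficientwise     *)
(* and theta(log t) = 1.                                                       *)
Definition thetaP (p : {poly fps K}) : {poly fps K} :=
  map_poly (@fps_theta K) p + p^`().

Definition LP (p : {poly fps K}) : {poly fps K} :=
  iter n thetaP p + \sum_(i < n) (a i)%:P * iter i thetaP p.

Definition frobenius (F : fps K) (Fr : nat -> {poly fps K}) : Prop :=
  [/\ fcoef F 0 = 1, Lfps F = 0, Fr 0%N = F%:P &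
   forall i, (0 < i < n)%N ->
     LP (Fr i) = 0 /\
     exists g : fps K,
       \sum_(r < i.+1) (-1) ^+ r * Fr (i - r)%N
                        * ((cst (r`!%:R)^-1)%:P * 'X^r) = g%:P].

(* theta-Wronskian wr_i of F_0, ..., F_i, and wr_{i-1} (with wr_{-1} = 1) *)
Definition wr (Fr : nat -> {poly fps K}) (i : nat) : {poly fps K} :=
  \det (\matrix_(r < i.+1, s < i.+1) iter s thetaP (Fr r)).

Definition wrm1 (Fr : nat -> {poly fps K}) (i : nat) : {poly fps K} :=
  if i is j.+1 then wr Fr j else 1.

(* (log q)' = theta(F_1/F), q = exp(F_1/F) *)
Definition dlogq (Fr : nat -> {poly fps K}) : {poly fps K} :=
  thetaP (qdiv (Fr 1%N) (Fr 0%N)).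

(* The module Lambda_L = K[[t]][theta]/K[[t]][theta] L, represented through  *)
(* its K[[t]]-basis eta, eta', ..., eta^(n-1): an element is the row vector  *)
(* of its coordinates.                                                       *)
Definition Lam := 'rV[fps K]_n.

(* coordinate of v on eta^(j) (0 if j >= n) *)
Definition coord (v : Lam) (j : nat) : fps K :=
  if insub j is Some k then v 0 k else 0.

Definition etab (r : nat) : Lam := \row_(j < n) ((j : nat) == r)%:R.

(* eta^(n) = theta^n eta = - sum_{i<n} a_i eta^(i) *)
Definition eta_n : Lam := - \sum_(i < n) a i *: etab i.

Definition etaS (r : nat) : Lam := if (r.+1 < n)%N then etab r.+1 else eta_n.

Definition thetaLam (v : Lam) : Lam :=
  \sum_(r < n) (fps_theta (v 0 r) *: etab r + v 0 r *: etaS r).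

(* Fil^i = K[[t]]-span of eta^(j), 0 <= j <= n-1-i *)
Definition Fil (i : nat) (v : Lam) : Prop :=
  forall j : 'I_n, (n <= j + i)%N -> v 0 j = 0.

Definition submoduleD (U : Lam -> Prop) : Prop :=
  [/\ U 0, (forall x y, U x -> U y -> U (x + y)),
      (forall (c : fps K) x, U x -> U (c *: x)) &
      (forall x, U x -> U (thetaLam x))].

Definition direct_sum (U V : Lam -> Prop) : Prop :=
  (forall v, exists x y, [/\ U x, V y & v = x + y]) /\
  (forall x, U x -> V x -> x = 0).

(* V/U (U a submodule of V) is a trivial K[[t]][theta]-module, i.e. it is  *)
(* isomorphic to (K[[t]]^m, theta): it is free with a basis (the classes of *)
(* w_1..w_m) of horizontal elements.                                        *)
Definition trivial_quot (U V : Lam -> Prop) : Prop :=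
  exists (m : nat) (w : 'I_m -> Lam),
    [/\ (forall j, V (w j) /\ U (thetaLam (w j))),
        (forall x, V x -> exists c : 'I_m -> fps K,
            U (x - \sum_(j < m) c j *: w j)) &
        (forall c : 'I_m -> fps K,
            U (\sum_(j < m) c j *: w j) -> forall j, c j = 0)].

Definition good_filtration (U : nat -> Lam -> Prop) : Prop :=
  [/\ (forall i, (i < n)%N -> submoduleD (U i)),
      (forall i, (i.+1 < n)%N -> forall x, U i x -> U i.+1 x),
      (forall i, (i < n)%N -> direct_sum (U i) (Fil i.+1)) &
      (forall i, (i.+1 < n)%N -> trivial_quot (U i) (U i.+1))].

Definition generates (U : nat -> Lam -> Prop) (u : nat -> Lam) : Prop :=
  forall i, (i < n)%N -> forall x,
    U i x <-> exists c : 'I_i.+1 -> fps K, x = \sum_(j < i.+1) c j *: u j.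

Definition normalized (beta : fps K) (Fr : nat -> {poly fps K}) (u : nat -> Lam)
  : Prop :=
  forall i, (i < n)%N ->
    Fil i (u i) /\
    (coord (u i) (n.-1 - i))%:P = beta%:P * qdiv (wr Fr i) (wrm1 Fr i).

End Operator.

(* Main.v *)
(* Let L_m be the monic operator of order m annihilating F_0, ..., F_(m-1), and
   f_m = L_m F_m. As d/dlog t commutes with L_m and maps F_m to F_(m-1), each f_m
   lies in 1 + tK[[t]]; moreover L_(m+1) = f_m theta f_m^-1 L_m, L_n = L and
   wr_m = f_0 ... f_m. Taking adjoints of the resulting factorisation
     L = f_(n-1) theta (f_(n-2) / f_(n-1)) theta ... theta f_0^-1
   gives a second one when L is self-adjoint. Such a factorisation is unique when
   all factors are in 1 + tK[[t]], whence beta f_i f_(n-1-i) = 1. The filtration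
   is the flag spanned by u_i = f_(n-1-i)^-1 L_(n-1-i) eta, and its uniqueness
   follows from the nilpotency of theta on Lambda modulo t. *)
Require Import Defs.
From HB Require Import structures.
From mathcomp Require Import all_boot all_order all_algebra.
From mathcomp Require Import boolp.
From mathcomp Require Import ring zify.
Import GRing.Theory.
Local Open Scope ring_scope.

Set Implicit Arguments.
Unset Strict Implicit.
Unset Printing Implicit Defensive.

(** * Power series *)

Section PowerSeries.
Variable K : fieldType.
Implicit Types f g : fps K.
Local Notation theta := (@fps_theta K).

Definition fps_coef k f : K := fcoef f k.

Lemma fps_coef_is_zmod_morphism k : zmod_morphism (fps_coef k).
Proof. by []. Qed.
HB.instance Definition _ k :=
  GRing.isZmodMorphism.Build (fps K) K (fps_coef k) (fps_coef_is_zmod_morphism k).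

Lemma fcoef0M f g : fcoef (f * g) 0 = fcoef f 0 * fcoef g 0.
Proof. by rewrite /= big_ord_recl big_ord0 addr0. Qed.

Lemma fps_coef0_is_monoid_morphism : monoid_morphism (fps_coef 0).
Proof. by split => // f g; exact: fcoef0M. Qed.
HB.instance Definition _ :=
  GRing.isMonoidMorphism.Build (fps K) K (fps_coef 0) fps_coef0_is_monoid_morphism.

Lemma fcoefD k f g : fcoef (f + g) k = fcoef f k + fcoef g k.
Proof. by []. Qed.

Lemma fcoefB k f g : fcoef (f - g) k = fcoef f k - fcoef g k.
Proof. by []. Qed.

Lemma fcoefMn k f m : fcoef (f *+ m) k = fcoef f k *+ m.
Proof. exact: (raddfMn (fps_coef k)). Qed.

Lemma fcoef1 : fcoef (1 : fps K) 0 = 1.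
Proof. by []. Qed.

Lemma theta_is_zmod_morphism : zmod_morphism theta.
Proof. by move=> f g; apply: fpsP => k /=; rewrite mulrBr. Qed.
HB.instance Definition _ :=
  GRing.isZmodMorphism.Build (fps K) (fps K) theta theta_is_zmod_morphism.

Lemma thetaM f g : theta (f * g) = theta f * g + f * theta g.
Proof.
apply: fpsP => k; rewrite fcoefD /= mulr_sumr -big_split /=.
apply: eq_bigr => i _; have le_ik : (i <= k)%N by rewrite -ltnS.
have -> : (k%:R : K) = i%:R + (k - i)%:R by rewrite -natrD subnKC.
by rewrite mulrDl mulrA [X in _ + X]mulrCA.
Qed.

Lemma theta1 : theta 1 = 0.
Proof. by apply: fpsP => -[|k] /=; rewrite ?mul0r ?mulr0. Qed.

Lemma fcoef_theta0 f : fcoef (theta f) 0 = 0.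
Proof. by rewrite /= mul0r. Qed.

(** Course-of-values recursion: the hypothesis says that [G k] reads only the values below [k]. It
    serves to solve for the coefficients of an inverse series. *)
Lemma fps_rec (G : nat -> (nat -> K) -> K) :
  (forall k (g g' : nat -> K), (forall j, (j < k)%N -> g j = g' j) -> G k g = G k g') ->
  exists g : nat -> K, forall k, g k = G k g.
Proof.
move=> extG.
(* [H k] tabulates the solution below [k] and is 0 elsewhere; [HE] says that later stages leave
   earlier values unchanged. *)
pose H := fix H k := if k is m.+1 then
  (fun j => if j == m then G m (H m) else H m j) else (fun=> 0).
have HE d j : H (j.+1 + d)%N j = H j.+1 j.
  elim: d => [|d IH]; first by rewrite addn0.
  by rewrite -IH addnS {1}/H -/H; case: eqP => // /eqP; rewrite ltn_eqF // leq_addr.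
exists (fun k => H k.+1 k) => k; rewrite {1}/H -/H eqxx.
by apply: extG => j ltjk; rewrite -(HE (k - j.+1)%N j) subnKC.
Qed.

Lemma fps_unit f : fcoef f 0 = 1 -> f \is a GRing.unit.
Proof.
move=> f0.
have [k g g' eqg|g gE] := @fps_rec (fun k (g : nat -> K) =>
    (k == 0)%N%:R - \sum_(i < k) fcoef f i.+1 * g (k - i.+1)%N).
  congr (_ - _); apply: eq_bigr => i _; rewrite eqg //.
  by rewrite ltn_subrL (leq_ltn_trans _ (ltn_ord i)).
apply/unitrPr; exists (FPS g); apply: fpsP => k /=.
by rewrite big_ord_recl /= f0 mul1r subn0 [g k]gE subrK.
Qed.

Lemma fcoef0V f : fcoef f 0 = 1 -> fcoef f^-1 0 = 1.
Proof.
move=> f0; have := congr1 (fun g => fcoef g 0%N) (mulrV (fps_unit f0)).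
by rewrite fcoef0M f0 mul1r.
Qed.

Definition fpsX (k : nat) : fps K := FPS (fun j => (j == k)%:R).

Lemma fcoef_fpsXM k f j : fcoef (fpsX k * f) (k + j) = fcoef f j.
Proof.
have lt : (k < (k + j).+1)%N by rewrite ltnS leq_addr.
rewrite /= (bigD1 (Ordinal lt)) //= eqxx mul1r addKn big1 ?addr0 // => i.
by rewrite -val_eqE /= => /negPf ->; rewrite mul0r.
Qed.

Lemma fpsXM_inj k : injective (fun f => fpsX k * f).
Proof.
move=> f g /= fg; apply: fpsP => j.
by rewrite -(fcoef_fpsXM k) fg fcoef_fpsXM.
Qed.

Lemma theta_fpsX k : theta (fpsX k) = k%:R * fpsX k.
Proof.
apply: fpsP => j; rewrite mulr_natl fcoefMn /=.
by case: eqP => [->|_]; rewrite ?mulr0 ?mul0rn // mulr1.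
Qed.

Lemma fpsX0 : fpsX 0 = 1.
Proof. by apply: fpsP. Qed.

Lemma map_thetaM (p q : {poly fps K}) :
  map_poly theta (p * q) = map_poly theta p * q + p * map_poly theta q.
Proof.
apply/polyP => k; rewrite coefD !coefM coef_map /= coefM raddf_sum -big_split /=.
by apply: eq_bigr => i _; rewrite !coef_map /= thetaM.
Qed.

Lemma map_thetaC f : map_poly theta f%:P = (theta f)%:P.
Proof. exact: map_polyC. Qed.

Lemma map_thetaX : map_poly theta 'X = 0.
Proof.
by apply/polyP => k; rewrite coef_map /= coefX coef0; case: eqP; rewrite ?theta1 ?raddf0.
Qed.

(** Natural numbers are constants for theta, so differentiating the coefficients is enough. *)
Lemma theta_horner_nat (p : {poly fps K}) k :
  theta p.[k%:R] = (map_poly theta p).[k%:R].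
Proof.
elim/poly_ind: p => [|p c IH]; first by rewrite horner0 !raddf0 horner0.
rewrite !raddfD /= map_thetaM map_thetaX mulr0 addr0 map_thetaC !hornerE.
by rewrite raddfD /= thetaM IH raddfMn /= theta1 mul0rn mulr0 addr0.
Qed.

Hypothesis charK0 : [pchar K] =i pred0.

Lemma natr_neq0 k : (k.+1%:R : K) != 0.
Proof. by move/pcharf0P: charK0 => ->. Qed.

Lemma theta_eq0 f : theta f = 0 -> fcoef f 0 = 0 -> f = 0.
Proof.
move=> f'0 f0; apply: fpsP => -[//|k].
have /eqP := congr1 (fun g => fcoef g k.+1) f'0.
by rewrite /= mulf_eq0 (negPf (natr_neq0 k)) => /eqP.
Qed.

Lemma theta_onto f : fcoef f 0 = 0 -> exists g, theta g = f.
Proof.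
move=> f0; exists (FPS (fun k => fcoef f k / k%:R)); apply: fpsP => -[|k] /=.
  by rewrite mul0r f0.
by rewrite mulrCA mulfV ?mulr1 ?natr_neq0.
Qed.

(* Compare lowest-order coefficients: the one of degree k satisfies
   k f_k = 0. *)
Lemma theta_eq_mul0 c f : fcoef c 0 = 0 -> fcoef f 0 = 0 ->
  theta f = c * f -> f = 0.
Proof.
move=> c0 f0 f'; apply: fpsP => k; elim/ltn_ind: k => -[//|k] IH.
have /eqP := congr1 (fun g => fcoef g k.+1) f'.
rewrite /= big_ord_recl c0 mul0r add0r big1 => [|i _].
  by rewrite mulf_eq0 (negPf (natr_neq0 k)) => /eqP.
by rewrite IH ?mulr0 //= /bump add1n subSS ltnS leq_subr.
Qed.

Lemma natr_fps_unit k : (k.+1%:R : fps K) \is a GRing.unit.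
Proof.
apply/unitrPr; exists (cst k.+1%:R^-1).
apply: fpsP => j; rewrite mulr_natl fcoefMn /=.
case: eqP => _; last by rewrite mul0rn.
by rewrite -[LHS]mulr_natl mulfV ?natr_neq0.
Qed.

(** In characteristic 0 the points [k.+1%:R] have invertible pairwise differences, so a nonzero
    polynomial vanishes at fewer of them than its size. *)
Lemma poly_fps_eq (p q : {poly fps K}) :
  (forall k, p.[k.+1%:R] = q.[k.+1%:R]) -> p = q.
Proof.
move=> pq; apply/eqP; rewrite -subr_eq0; apply: contraT => nz.
pose s := [seq k.+1%:R : fps K | k <- iota 0 (size (p - q))].
have := @max_ring_poly_roots _ (p - q) s nz.
rewrite size_map size_iota ltnn => -> //.
  by apply/allP => x /mapP[k _ ->]; rewrite /root !hornerE pq subrr.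
rewrite /s; move: (size _) 0%N => m; elim: m => [//|m IH] b /=.
rewrite IH andbT; apply/allP => x /mapP[k]; rewrite mem_iota => /andP[bk _] ->.
rewrite /diff_roots mulrC eqxx /= -natrB; last by rewrite ltnS ltnW.
by rewrite subSS -(subnSK bk) natr_fps_unit.
Qed.

(** * Products of theta with multiplication operators *)

Implicit Types h : nat -> fps K.

(** This is the operator h_m theta h_(m-1) theta ... theta h_0 applied to f. *)
Fixpoint theta_chain h m f : fps K :=
  if m is j.+1 then h m * theta (theta_chain h j f) else h 0%N * f.

Lemma theta_chainSr h m f :
  theta_chain h m.+1 f = theta_chain (fun j => h j.+1) m (theta (h 0%N * f)).
Proof. by elim: m => [//|m IH]; rewrite [LHS]/= -/(theta_chain h m.+1 f) IH. Qed.

Lemma eq_theta_chain h h' m f : (forall j, (j <= m)%N -> h j = h' j) ->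
  theta_chain h m f = theta_chain h' m f.
Proof.
elim: m => [|m IH] hh' /=; first by rewrite hh'.
by rewrite hh' // IH // => j lejm; rewrite hh' // ltnW.
Qed.

Lemma theta_chainMl c h m f : c * theta_chain h m.+1 f =
  theta_chain (fun j => if j == m.+1 then c * h j else h j) m.+1 f.
Proof.
rewrite /= eqxx mulrA; congr (_ * theta _); apply: eq_theta_chain => j lejm.
by rewrite ltn_eqF.
Qed.

Lemma theta_chainMr c h m f : theta_chain h m (c * f) =
  theta_chain (fun j => if j == 0%N then h j * c else h j) m f.
Proof. by elim: m => [|m IH] /=; rewrite ?mulrA // IH. Qed.

Lemma theta_chainB h m f g :
  theta_chain h m (f - g) = theta_chain h m f - theta_chain h m g.
Proof. by elim: m => [|m IH] /=; rewrite ?IH ?raddfB -mulrBr. Qed.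

Lemma theta_chain0 h m : theta_chain h m 0 = 0.
Proof. by rewrite -{1}(subrr 0) theta_chainB subrr. Qed.

Lemma fcoef_theta_chain0 h m f : fcoef f 0 = 0 ->
  fcoef (theta_chain h m f) 0 = 0.
Proof. by case: m => [|m] f0; rewrite [theta_chain _ _ _]/= fcoef0M ?f0 ?fcoef_theta0 mulr0. Qed.

(** Every intermediate series stays in tK[[t]], where theta is injective, and the factors are
    units. *)
Lemma theta_chain_eq0 h m f : (forall j, (j <= m)%N -> fcoef (h j) 0 = 1) ->
  fcoef f 0 = 0 -> theta_chain h m f = 0 -> f = 0.
Proof.
move=> h1 f0; elim: m h1 => [|m IH] h1 /=.
  by move/(canRL (mulKr (fps_unit (h1 0%N (leqnn _))))); rewrite mulr0.
move/(canRL (mulKr (fps_unit (h1 m.+1 (leqnn _))))); rewrite mulr0.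
move/theta_eq0 => /(_ (fcoef_theta_chain0 _ _ f0)); apply: IH => j lejm.
by rewrite h1 // ltnW.
Qed.

(** From theta (t^k g) = t^k (theta g + k g), one more factor h replaces p by h (theta p + p X),
    with the same p for all k. *)
Lemma theta_chain_fpsX h m : exists p : {poly fps K},
  forall k, theta_chain h m (fpsX k) = fpsX k * p.[k%:R].
Proof.
elim: m => [|m [p IH]] /=.
  by exists (h 0%N)%:P => k; rewrite hornerC mulrC.
exists ((h m.+1)%:P * (map_poly theta p + p * 'X)) => k.
rewrite IH thetaM theta_fpsX theta_horner_nat hornerCM hornerD hornerMX.
by ring.
Qed.

(* On t^k a chain acts as multiplication by a polynomial in k, which is
   determined by its values at k > 0. *)
Lemma theta_chain_ext h h' m :
  (forall f, fcoef f 0 = 0 -> theta_chain h m f = theta_chain h' m f) ->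
  theta_chain h m =1 theta_chain h' m.
Proof.
move=> eq0 f.
have [p pE] := theta_chain_fpsX h m; have [q qE] := theta_chain_fpsX h' m.
have pq : p = q.
  by apply: poly_fps_eq => k; apply: (@fpsXM_inj k.+1) => /=; rewrite -pE -qE eq0.
(* Constants come out of the chain, which reduces the claim to 1 = t^0, that is, to the values of p
   and q at 0. *)
have eqc c : theta_chain h m (cst c) = theta_chain h' m (cst c).
  have E h0 : theta_chain h0 m (cst c) = cst c * theta_chain h0 m 1.
    elim: {eq0 p q pE qE pq} m => [|m IH] /=; first by rewrite mulr1 mulrC.
    rewrite IH thetaM; suff -> : theta (cst c) = 0 by rewrite mul0r add0r mulrCA.
    by apply: fpsP => -[|k] /=; rewrite ?mul0r ?mulr0.
  by rewrite !E -fpsX0 pE qE pq.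
have split h0 : theta_chain h0 m f =
    theta_chain h0 m (f - cst (fcoef f 0)) + theta_chain h0 m (cst (fcoef f 0)).
  by rewrite theta_chainB subrK.
by rewrite !split eqc eq0 // fcoefB /= subrr.
Qed.

(* The kernel of the chain on K[[t]] is spanned by the inverse of h 0, which
   determines h 0; the remaining factors are found by induction. *)
Lemma theta_chain_inj h h' m :
  (forall j, (j <= m)%N -> fcoef (h j) 0 = 1) ->
  (forall j, (j <= m)%N -> fcoef (h' j) 0 = 1) ->
  theta_chain h m =1 theta_chain h' m -> forall j, (j <= m)%N -> h j = h' j.
Proof.
elim: m h h' => [|m IH] h h' h1 h'1 hh'.
  by move=> j; rewrite leqn0 => /eqP ->; move: (hh' 1); rewrite /= !mulr1.
have hU := fps_unit (h1 0%N isT).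
have h0E : h' 0%N = h 0%N.
  (* The first chain kills the inverse of [h 0], hence so does the second. So theta (h'_0 / h_0) =
     0, and this quotient, with constant term 1, equals 1. *)
  have := hh' (h 0%N)^-1; rewrite !theta_chainSr mulrV // theta1 theta_chain0.
  move/esym/theta_chain_eq0 => H.
  have /(theta_eq0) : theta (h' 0%N / h 0%N - 1) = 0.
    by rewrite raddfB /= theta1 subr0 H ?fcoef_theta0 // => j lejm; apply: h'1.
  rewrite fcoefB fcoef0M h'1 // fcoef0V ?h1 // fcoef1 mulr1 subrr => /(_ erefl)/eqP.
  by rewrite subr_eq0 => /eqP/(canRL (mulrVK hU)); rewrite mul1r.
case=> [//|j]; rewrite ltnS; move: j.
apply: (IH (fun j => h j.+1) (fun j => h' j.+1)) => [i|i|].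
- by move=> leim; apply: h1.
- by move=> leim; apply: h'1.
(* Once the innermost factor is removed, equality is known only on the image of theta, which is
   tK[[t]]. *)
apply: theta_chain_ext => f /theta_onto[g <-].
by have := hh' ((h 0%N)^-1 * g); rewrite !theta_chainSr h0E mulVKr.
Qed.

End PowerSeries.

(** * Logarithmic series and the cyclic module *)

Lemma iter_is_zmod_morphism (V : zmodType) (f : {additive V -> V}) m :
  zmod_morphism (iter m f).
Proof. by move=> x y; elim: m => //= m ->; rewrite raddfB. Qed.
HB.instance Definition _ (V : zmodType) (f : {additive V -> V}) m :=
  GRing.isZmodMorphism.Build V V (iter m f) (@iter_is_zmod_morphism V f m).

Section LogSeries.
Variable K : fieldType.
Implicit Types (f g : fps K) (p q : {poly fps K}).
Local Notation theta := (@fps_theta K).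
Local Notation thetaP := (@thetaP K).

Lemma thetaP_is_zmod_morphism : zmod_morphism thetaP.
Proof. by move=> p q; rewrite /thetaP !raddfB /= addrACA -opprD. Qed.
HB.instance Definition _ :=
  GRing.isZmodMorphism.Build {poly fps K} {poly fps K} thetaP thetaP_is_zmod_morphism.

Lemma thetaPM p q : thetaP (p * q) = thetaP p * q + p * thetaP q.
Proof. by rewrite /thetaP map_thetaM derivM; ring. Qed.

Lemma thetaPC f : thetaP f%:P = (theta f)%:P.
Proof. by rewrite /thetaP map_thetaC derivC addr0. Qed.

Lemma iter_thetaPC m f : iter m thetaP f%:P = (iter m theta f)%:P.
Proof. by elim: m => //= m ->; rewrite thetaPC. Qed.

(** The formal derivative is d/dlog t, and this commutation extends to every operator with
    coefficients in K[[t]] ([deriv_act]). *)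
Lemma deriv_thetaP p : (thetaP p)^`() = thetaP p^`().
Proof.
rewrite /thetaP derivD; congr (_ + _); apply/polyP => k.
by rewrite coef_deriv !coef_map /= coef_deriv raddfMn.
Qed.

Lemma deriv_iter_thetaP m p : (iter m thetaP p)^`() = iter m thetaP p^`().
Proof. by elim: m => //= m <-; rewrite deriv_thetaP. Qed.

(** Reduction modulo t, from K[[t]][log t] to K[log t]; theta becomes d/dlog t. *)
Definition ev0 : {poly fps K} -> {poly K} := map_poly (@fps_coef K 0).
HB.instance Definition _ := GRing.RMorphism.on ev0.

Lemma ev0C f : ev0 f%:P = (fcoef f 0)%:P.
Proof. exact: map_polyC. Qed.

Lemma ev0_thetaP p : ev0 (thetaP p) = (ev0 p)^`().
Proof.
apply/polyP => k; rewrite coef_deriv !coef_map coefD coef_map coef_deriv.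
rewrite -[LHS]/(fcoef (theta p`_k + p`_k.+1 *+ k.+1) 0).
by rewrite fcoefD fcoef_theta0 add0r fcoefMn.
Qed.

Lemma deriv_eq0_polyC p : [pchar K] =i pred0 -> p^`() = 0 -> p = (p`_0)%:P.
Proof.
move=> charK0 p'0; apply/polyP => -[|k]; rewrite coefC //=.
have := congr1 (fun q : {poly _} => q`_k) p'0; rewrite coef_deriv coef0 -mulr_natl.
by move/(canRL (mulKr (natr_fps_unit charK0 k))); rewrite mulr0.
Qed.

(** Invertibility of the divisor makes the quotient unique, so the choice inside [qdiv] is
    forced. *)
Lemma qdivE (R : comNzRingType) (x y z : R) : (exists w, w * y = 1) ->
  z * y = x -> qdiv x y = z.
Proof.
move=> [w wy] zx; rewrite /qdiv; case: pselect => [H|[]]; last by exists z.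
case: (cid H) => z' /= z'x.
by rewrite -[LHS]mulr1 -wy mulrCA z'x -zx mulrCA wy mulr1.
Qed.

Lemma qdivPC f g p : g \is a GRing.unit -> p = f%:P * g%:P -> qdiv p g%:P = f%:P.
Proof.
move=> gU ->; apply: qdivE => //.
by exists (g^-1)%:P; rewrite -polyCM mulVr.
Qed.

End LogSeries.

(** * Elements of Lambda as differential operators, and their adjoints *)

Section Cyclic.
Variables (K : fieldType) (n : nat) (a : nat -> fps K).
Implicit Types (f g : fps K) (p q : {poly fps K}) (v w : Lam K n.+1).
Local Notation theta := (@fps_theta K).
Local Notation thetaP := (@thetaP K).
Local Notation thetaLam := (@thetaLam K n.+1 a).

(** Companion form of the connection. The order is [n.+1], so [ord_max] indexes eta^(n), whose
    derivative brings in the a_j. *)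
Lemma thetaLamE v j : thetaLam v 0 j =
  theta (v 0 j) + (if (0 < j)%N then v 0 (inord j.-1) else 0) - v 0 ord_max * a j.
Proof.
rewrite /Defs.thetaLam summxE.
under eq_bigr => r _ do rewrite !mxE.
rewrite big_split /= -addrA; congr (_ + _).
  rewrite (bigD1 j) //= eqxx mulr1 big1 ?addr0 // => i /negPf.
  by rewrite -val_eqE eq_sym /= => ->; rewrite mulr0.
rewrite big_ord_recr /= /etaS ltnn; congr (_ + _).
  under eq_bigr => i _ do rewrite ltnS ltn_ord !mxE.
  case: ifP => [j_gt0|/negbT].
    have lt : (j.-1 < n)%N by rewrite -ltnS prednK.
    rewrite (bigD1 (Ordinal lt)) //= prednK // eqxx mulr1 big1 ?addr0.
      by congr (v 0 _); apply/val_inj; rewrite /= inordK // ltnS ltnW.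
    move=> i; rewrite -val_eqE /= => /negPf ne.
    by rewrite -(prednK j_gt0) eqSS eq_sym ne mulr0.
  rewrite -eqn0Ngt => /eqP ->.
  by rewrite big1 // => i _; rewrite mulr0.
rewrite /eta_n !mxE summxE (bigD1 j) //= !mxE eqxx mulr1 big1 ?addr0 ?mulrN //.
by move=> i; rewrite -val_eqE eq_sym !mxE /= => /negPf ->; rewrite mulr0.
Qed.

Lemma thetaLamD v w : thetaLam (v + w) = thetaLam v + thetaLam w.
Proof.
apply/rowP => j; rewrite mxE !thetaLamE !mxE raddfD /=.
by case: ifP => _; ring.
Qed.

Lemma thetaLamZ f v : thetaLam (f *: v) = theta f *: v + f *: thetaLam v.
Proof.
apply/rowP => j; rewrite !mxE !thetaLamE !mxE thetaM.
by case: ifP => _; ring.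
Qed.

(** The class v has a unique representative of order at most n; this applies it to a logarithmic
    series. *)
Definition act v p : {poly fps K} := \sum_(r < n.+1) (v 0 r)%:P * iter r thetaP p.

Lemma actZ f v p : act (f *: v) p = f%:P * act v p.
Proof.
by rewrite /act mulr_sumr; apply: eq_bigr => r _; rewrite mxE polyCM mulrA.
Qed.

(** If P represents v and w is its coefficient of theta^n, then theta P - w L has order at most n
    and represents theta v. *)
Lemma act_thetaLam v p :
  act (thetaLam v) p = thetaP (act v p) - (v 0 ord_max)%:P * LP n.+1 a p.
Proof.
rewrite /act raddf_sum /=; under eq_bigr => r _ do rewrite thetaLamE.
under [X in _ = X - _]eq_bigr => r _ do rewrite thetaPM thetaPC.
have -> : \sum_(r < n.+1) (theta (v 0 r) +
    (if (0 < r)%N then v 0 (inord r.-1) else 0) - v 0 ord_max * a r)%:P * iter r thetaP p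
  = \sum_(r < n.+1) (theta (v 0 r))%:P * iter r thetaP p +
    \sum_(r < n.+1) (if (0 < r)%N then v 0 (inord r.-1) else 0)%:P * iter r thetaP p
    - (v 0 ord_max)%:P * \sum_(r < n.+1) (a r)%:P * iter r thetaP p.
  rewrite mulr_sumr -big_split -sumrB /=; apply: eq_bigr => r _.
  by rewrite polyCB polyCD polyCM; ring.
rewrite [in RHS]big_split /= /LP mulrDr [X in _ - X]addrC opprD addrA.
rewrite -!addrA; congr (_ + _); rewrite [RHS]addrCA [LHS]addrC; congr (_ + _).
rewrite big_ord_recl /= mul0r add0r big_ord_recr /= addrK.
apply: eq_bigr => i _; congr (_%:P * _); congr (v 0 _).
by apply/val_inj; rewrite /= add0n inordK // ltnS ltnW.
Qed.

Lemma LP_polyC f : LP n.+1 a f%:P = (Lfps n.+1 a f)%:P.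
Proof.
rewrite /LP /Lfps iter_thetaPC polyCD raddf_sum /=; congr (_ + _).
by apply: eq_bigr => r _; rewrite iter_thetaPC polyCM.
Qed.

Lemma deriv_act v p : (act v p)^`() = act v p^`().
Proof.
rewrite /act raddf_sum /=; apply: eq_bigr => r _.
by rewrite derivM derivC mul0r add0r deriv_iter_thetaP.
Qed.

Definition adjoint v f : fps K :=
  \sum_(r < n.+1) (-1) ^+ r * iter r theta (v 0 r * f).

Lemma adjointZ f v g : adjoint (f *: v) g = adjoint v (f * g).
Proof.
by apply: eq_bigr => r _; rewrite mxE [in RHS]mulrCA [in RHS]mulrA.
Qed.

(** The representative of theta v is theta P - w L, with adjoint - P^* theta - L^* w. In coordinates
    the shifted terms cancel, and the top one becomes the leading term of [Lstar]. *)
Lemma adjoint_thetaLam v f : adjoint (thetaLam v) f =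
  - adjoint v (theta f) - Lstar n.+1 a (v 0 ord_max * f).
Proof.
rewrite /adjoint; under eq_bigr => r _ do rewrite thetaLamE.
set w := v 0 ord_max.
have -> : \sum_(r < n.+1) (-1) ^+ r * iter r theta ((theta (v 0 r) +
    (if (0 < r)%N then v 0 (inord r.-1) else 0) - w * a r) * f)
  = \sum_(r < n.+1) (-1) ^+ r * iter r theta (theta (v 0 r) * f) +
    \sum_(r < n.+1) (-1) ^+ r * iter r theta ((if (0 < r)%N then v 0 (inord r.-1) else 0) * f)
    - \sum_(r < n.+1) (-1) ^+ r * iter r theta (a r * (w * f)).
  rewrite -big_split -sumrB /=; apply: eq_bigr => r _.
  rewrite mulrBl mulrDl raddfB raddfD /= mulrBr mulrDr; congr (_ - _ * iter _ _ _).
  by ring.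
have -> : \sum_(r < n.+1) (-1) ^+ r * iter r theta (theta (v 0 r) * f) =
    \sum_(r < n.+1) (-1) ^+ r * iter r.+1 theta (v 0 r * f)
    - \sum_(r < n.+1) (-1) ^+ r * iter r theta (v 0 r * theta f).
  rewrite -sumrB; apply: eq_bigr => r _.
  by rewrite iterSr thetaM raddfD /=; ring.
have -> : \sum_(r < n.+1) (-1) ^+ r * iter r.+1 theta (v 0 r * f) =
    \sum_(i < n) (-1) ^+ i * iter i.+1 theta (v 0 (inord i) * f)
    + (-1) ^+ n * iter n.+1 theta (w * f).
  rewrite big_ord_recr; congr (_ + _); apply: eq_bigr => i _.
  congr (_ * iter _ _ (v 0 _ * _)).
  by apply/val_inj; rewrite /= inordK // ltnS ltnW.
have -> : \sum_(r < n.+1) (-1) ^+ r *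
      iter r theta ((if (0 < r)%N then v 0 (inord r.-1) else 0) * f) =
    - \sum_(i < n) (-1) ^+ i * iter i.+1 theta (v 0 (inord i) * f).
  rewrite big_ord_recl mul0r raddf0 mulr0 add0r -sumrN; apply: eq_bigr => i _.
  by rewrite lift0 exprS mulN1r mulNr.
by rewrite /Lstar exprS; ring.
Qed.

End Cyclic.

(** * Factorisation of the operator *)

Section Factorization.
Variables (K : fieldType) (charK0 : [pchar K] =i pred0).
Variables (n : nat) (a : nat -> fps K) (F : fps K) (Fr : nat -> {poly fps K}).
Hypothesis frobF : frobenius n.+1 a F Fr.
Implicit Types (f g : fps K) (p q : {poly fps K}) (v w : Lam K n.+1).
Local Notation theta := (@fps_theta K).
Local Notation thetaP := (@thetaP K).
Local Notation thetaLam := (@thetaLam K n.+1 a).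
Local Notation etab := (@etab K n.+1).

Let logX r : {poly fps K} := (cst r`!%:R^-1)%:P * 'X^r.

Lemma deriv_logX r : (logX r.+1)^`() = logX r.
Proof.
rewrite derivM derivC mul0r add0r derivXn /= mulrnAr -mulrnAl -polyCMn.
congr (_%:P * _); apply: fpsP => k; rewrite fcoefMn /=.
case: eqP => _; last by rewrite mul0rn.
by rewrite factS natrM invfM -[LHS]mulr_natl mulrA mulfV ?mul1r ?natr_neq0.
Qed.

Lemma logX0 : logX 0 = 1.
Proof.
rewrite /logX mulr1 invr1; congr (_%:P).
by apply: fpsP => k /=; case: eqP.
Qed.

(** Differentiate the Frobenius normalisation with respect to log t: by induction all terms but two
    telescope. *)
Lemma deriv_Fr i : (i <= n)%N -> (Fr i)^`() = if i is j.+1 then Fr j else 0.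
Proof.
have [_ _ Fr0 frobFr] := frobF.
elim/ltn_ind: i => -[_ _|j IH lejn]; first by rewrite Fr0 derivC.
have [|_ [g]] := frobFr j.+1; first by rewrite ltnS.
rewrite big_ord_recl /= subn0 expr0 mul1r -/(logX 0) logX0 mulr1.
move/(congr1 (fun p => p^`())); rewrite derivC derivD raddf_sum.
suff -> : \sum_(i < j.+1) (((-1) ^+ bump 0 i * Fr (j.+1 - bump 0 i)%N *
    ((cst (bump 0 i)`!%:R^-1)%:P * 'X^(bump 0 i)))^`()) = - Fr j.
  by move/eqP; rewrite subr_eq0 => /eqP.
pose G s := (-1) ^+ s * Fr (j - s)%N * logX s.
(* For s = j the factor differentiated is F_0, which is free of log t; hence the value 0. *)
rewrite (eq_bigr (fun s : 'I_j.+1 =>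
  (if (s < j)%N then G s.+1 else 0) - G s)); last first.
  move=> s _; rewrite /bump add1n subSS -/(logX s.+1) derivM deriv_logX derivM.
  have -> : ((-1) ^+ s.+1 : {poly fps K})^`() = 0.
    have -> : (-1) ^+ s.+1 = ((-1) ^+ s.+1)%:P :> {poly fps K} by rewrite rmorphXn rmorphN1.
    exact: derivC.
  rewrite mul0r add0r exprS mulN1r !mulNr; congr (_ - _).
  rewrite IH ?ltnS ?leq_subr //; last by rewrite (leq_trans (leq_subr _ _)) // ltnW.
  have := ltn_ord s; rewrite ltnS leq_eqVlt => /orP[/eqP ->|lt_sj].
    by rewrite subnn ltnn mulr0 mul0r oppr0.
  by rewrite lt_sj /G exprS mulN1r !mulNr -(subnSK lt_sj).
rewrite sumrB big_ord_recr /= ltnn addr0 [X in _ - X]big_ord_recl /=.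
under eq_bigr => s _ do rewrite ltn_ord.
by rewrite opprD addrCA subrr addr0 /G subn0 mul1r logX0 mulr1.
Qed.

Lemma LP_Fr i : (i <= n)%N -> LP n.+1 a (Fr i) = 0.
Proof.
have [_ LF Fr0 frobFr] := frobF; case: i => [_|i lein].
  by rewrite Fr0 LP_polyC LF.
by have [] := frobFr i.+1; rewrite ?ltnS.
Qed.

(* [ell m] is the class of the monic operator of order m annihilating
   F_0, ..., F_(m-1). *)
Fixpoint ell (m : nat) : Lam K n.+1 :=
  if m is j.+1 then
    let f := (act (ell j) (Fr j))`_0 in f *: thetaLam (f^-1 *: ell j)
  else etab 0.

(** The series f_m. Taking the coefficient of log^0 t loses nothing, by [act_ell_lead]. *)
Definition lead m : fps K := (act (ell m) (Fr m))`_0.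

Lemma ellS m : ell m.+1 = lead m *: thetaLam ((lead m)^-1 *: ell m).
Proof. by []. Qed.

(** For m < n the correction vanishes, as [ell m] has order m; for m = n it is the reduction modulo
    L. *)
Lemma act_ellS m p : lead m \is a GRing.unit ->
  act (ell m.+1) p = (lead m)%:P * thetaP ((lead m)^-1%:P * act (ell m) p)
    - (ell m 0 ord_max)%:P * LP n.+1 a p.
Proof.
move=> U; rewrite ellS actZ act_thetaLam actZ mulrBr; congr (_ - _).
by rewrite mxE polyCM !mulrA -polyCM mulrV // mul1r.
Qed.

Lemma act_ell0 p : act (ell 0) p = p.
Proof.
rewrite /act big_ord_recl /= mxE mul1r big1 ?addr0 // => i _.
by rewrite mxE mul0r.
Qed.

(** All claims go through one induction, since the next operator needs f_m to be an invertible
    series free of log t. Modulo t the operator L_m is the m-th power of d/dlog t, which gives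
    f_m(0) = 1. *)
Lemma ell_spec m : (m <= n)%N ->
  [/\ (forall j : 'I_n.+1, (m <= j)%N -> ell m 0 j = (j == m :> nat)%:R),
      (forall i, (i < m)%N -> act (ell m) (Fr i) = 0),
      (forall p, ev0 (act (ell m) p) = (ev0 p)^`(m)),
      act (ell m) (Fr m) = (lead m)%:P & fcoef (lead m) 0 = 1].
Proof.
have [F1 _ Fr0 _] := frobF.
suff main : (m <= n)%N ->
  [/\ (forall j : 'I_n.+1, (m <= j)%N -> ell m 0 j = (j == m :> nat)%:R),
      (forall i, (i < m)%N -> act (ell m) (Fr i) = 0) &
      (forall p, ev0 (act (ell m) p) = (ev0 p)^`(m))] /\
      (act (ell m) (Fr m) = (lead m)%:P /\ fcoef (lead m) 0 = 1).
  by move=> /main[[? ? ?] []].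
elim: m => [_|m IH ltmn].
  split; first split=> // [j _|p]; first by rewrite mxE.
    by rewrite act_ell0.
  by rewrite /lead act_ell0 Fr0 coefC eqxx.
have {IH} [[ell_m act0m ev_m] [lead_m lead1]] := IH (ltnW ltmn).
have U := fps_unit lead1.
have last0 : ell m 0 ord_max = 0 by rewrite ell_m /= ?gtn_eqF // ltnW.
have actS p : act (ell m.+1) p =
    (lead m)%:P * thetaP ((lead m)^-1%:P * act (ell m) p).
  by rewrite act_ellS // last0 mul0r subr0.
have act0 i : (i < m.+1)%N -> act (ell m.+1) (Fr i) = 0.
  rewrite ltnS leq_eqVlt => /orP[/eqP ->|lt_im]; rewrite actS.
    by rewrite lead_m -polyCM mulVr // thetaPC theta1 mulr0.
  by rewrite act0m // mulr0 raddf0 mulr0.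
have evS p : ev0 (act (ell m.+1) p) = (ev0 p)^`(m.+1).
  rewrite actS rmorphM /= ev0C lead1 mul1r ev0_thetaP rmorphM /= ev0C.
  by rewrite fcoef0V // mul1r ev_m.
split; first split=> //.
  move=> j lt_mj; rewrite ellS !mxE thetaLamE !mxE last0 mulr0 mul0r subr0.
  rewrite (ell_m j (ltnW lt_mj)) gtn_eqF // mulr0 raddf0 add0r.
  have j_gt0 : (0 < j)%N by rewrite (leq_ltn_trans _ lt_mj).
  have ltj : (j.-1 < n.+1)%N by rewrite (leq_ltn_trans (leq_pred _)).
  rewrite j_gt0 mulVKr // ell_m inordK //; last by rewrite -ltnS prednK.
  by rewrite -[in RHS](prednK j_gt0) eqSS.
(* Its derivative in log t is L_(m+1) F_m = 0. *)
have E : act (ell m.+1) (Fr m.+1) = (lead m.+1)%:P.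
  apply: deriv_eq0_polyC => //; rewrite deriv_act deriv_Fr //; exact: act0.
split=> //.
have evFr i : (i <= n)%N -> (ev0 (Fr i))^`(i) = 1.
  elim: i => [_|i IH ltin]; first by rewrite derivn0 Fr0 ev0C F1.
  rewrite derivSn; have -> : (ev0 (Fr i.+1))^`() = ev0 (Fr i.+1)^`().
    by apply/polyP => k; rewrite coef_deriv !coef_map /= coef_deriv /fps_coef fcoefMn.
  by rewrite deriv_Fr // IH // ltnW.
have := evS (Fr m.+1); rewrite evFr // E ev0C => /(congr1 (fun p : {poly K} => p`_0)).
by rewrite !coefC.
Qed.

Lemma ell_coord m (j : 'I_n.+1) : (m <= n)%N -> (m <= j)%N ->
  ell m 0 j = (j == m :> nat)%:R.
Proof. by move=> /ell_spec[H _ _ _ _]; apply: H. Qed.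

Lemma act_ell_eq0 m i : (m <= n)%N -> (i < m)%N -> act (ell m) (Fr i) = 0.
Proof. by move=> /ell_spec[_ H _ _ _]; apply: H. Qed.

Lemma act_ell_lead m : (m <= n)%N -> act (ell m) (Fr m) = (lead m)%:P.
Proof. by move=> /ell_spec[]. Qed.

Lemma lead1 m : (m <= n)%N -> fcoef (lead m) 0 = 1.
Proof. by move=> /ell_spec[]. Qed.

Lemma lead_unit m : (m <= n)%N -> lead m \is a GRing.unit.
Proof. by move=> lemn; apply/fps_unit/lead1. Qed.

Lemma lead0 : lead 0 = F.
Proof. by have [_ _ Fr0 _] := frobF; rewrite /lead act_ell0 Fr0 coefC eqxx. Qed.

(* Multiplying the Wronskian matrix by the unitriangular matrix of the
   coordinates of the ell m makes it triangular with diagonal (lead m). *)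
Lemma wrE i : (i <= n)%N -> wr Fr i = (\prod_(j < i.+1) lead j)%:P.
Proof.
move=> lein.
pose W := \matrix_(r < i.+1, s < i.+1) iter s thetaP (Fr r).
pose B := \matrix_(s < i.+1, m < i.+1) (ell m 0 (inord s))%:P.
have le_n (m : 'I_i.+1) : (m <= n)%N by rewrite (leq_trans _ lein) // -ltnS.
have WB : W *m B = \matrix_(r < i.+1, m < i.+1) act (ell m) (Fr r).
  apply/matrixP => r m; rewrite !mxE.
  rewrite /act (eq_bigr (fun s : 'I_n.+1 => (ell m 0 (inord s))%:P * iter s thetaP (Fr r))).
    have lein' : (i.+1 <= n.+1)%N by [].
    rewrite (bigID (fun s : 'I_n.+1 => (s < i.+1)%N)) /= [X in _ = _ + X]big1 ?addr0.
      rewrite -(big_ord_widen _ (fun s => (ell m 0 (inord s))%:P * iter s thetaP (Fr r)) lein').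
      by apply: eq_bigr => s _; rewrite !mxE mulrC.
    move=> s; rewrite -leqNgt => lt_is.
    have lt_ms : (m < s)%N by rewrite (leq_trans _ lt_is).
    by rewrite inord_val ell_coord ?le_n ?gtn_eqF ?mul0r // ltnW.
  by move=> s _; rewrite inord_val.
have detB : \det B = 1.
  rewrite -det_tr det_trig.
    rewrite big1 // => s _; rewrite !mxE ell_coord ?le_n ?inordK ?eqxx //.
      by rewrite ltnS le_n.
    by rewrite ltnS le_n.
  apply/is_trig_mxP => m s lt_ms; rewrite !mxE ell_coord ?le_n ?inordK ?gtn_eqF ?ltnS ?le_n //.
  exact: ltnW.
have -> : wr Fr i = \det (W *m B) by rewrite det_mulmx detB mulr1.
rewrite WB det_trig.
  rewrite rmorph_prod; apply: eq_bigr => m _.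
  by rewrite mxE act_ell_lead ?le_n.
by apply/is_trig_mxP => r m lt_rm; rewrite mxE act_ell_eq0 ?le_n.
Qed.

(** The class is represented by L_(n+1) - L, of order at most n. It kills F_0, ..., F_n, whose
    Wronskian is invertible, so it is zero and L_(n+1) = L. *)
Lemma ell_last : ell n.+1 = 0.
Proof.
pose W := \matrix_(r < n.+1, s < n.+1) iter s thetaP (Fr r).
have wU : \prod_(j < n.+1) lead j \is a GRing.unit.
  by apply: rpred_prod => j _; rewrite lead_unit // -ltnS.
pose v : 'cV[{poly fps K}]_n.+1 := \col_s (ell n.+1 0 s)%:P.
have Wv : W *m v = 0.
  apply/colP => r; rewrite !mxE.
  have lern : (r <= n)%N by rewrite -ltnS.
  have E : act (ell n.+1) (Fr r) = 0.
    rewrite act_ellS ?lead_unit // LP_Fr // mulr0 subr0.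
    move: lern; rewrite leq_eqVlt => /orP[/eqP ->|lt_rn].
      by rewrite act_ell_lead // -polyCM mulVr ?lead_unit // thetaPC theta1 mulr0.
    by rewrite act_ell_eq0 // mulr0 raddf0 mulr0.
  by rewrite -[RHS]E; apply: eq_bigr => s _; rewrite !mxE mulrC.
apply/rowP => s; apply: polyC_inj; rewrite mxE.
(* The adjugate turns W v = 0 into wr_n v = 0. *)
have := congr1 (fun u => (\adj W *m u) s 0) Wv.
rewrite mulmxA mul_adj_mx -/(wr Fr n) wrE // mulmx0 mul_scalar_mx !mxE -polyCM.
by move/polyC_inj/(canRL (mulKr wU)); rewrite mulr0 => ->.
Qed.

(** The elements u_i of the flag in reverse order: u_i is [ebas (n - i)]. *)
Definition ebas m : Lam K n.+1 := (lead m)^-1 *: ell m.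

Lemma theta_ebas m : (m < n)%N ->
  thetaLam (ebas m) = (lead m.+1 / lead m) *: ebas m.+1.
Proof.
move=> ltmn; rewrite /ebas scalerA mulrAC mulrV ?lead_unit // mul1r ellS.
by rewrite scalerA mulVr ?scale1r // lead_unit // ltnW.
Qed.

Lemma theta_ebas_last : thetaLam (ebas n) = 0.
Proof.
have := ellS n; rewrite ell_last => /(congr1 (fun v => (lead n)^-1 *: v)).
by rewrite scaler0 scalerA mulVr ?lead_unit // scale1r.
Qed.

Lemma ebas_coord m (j : 'I_n.+1) : (m <= n)%N -> (m <= j)%N ->
  ebas m 0 j = if j == m :> nat then (lead m)^-1 else 0.
Proof.
by move=> lemn lemj; rewrite mxE ell_coord //; case: eqP; rewrite ?mulr1 ?mulr0.
Qed.

(* The factors of L = h_(n+1) theta h_n ... theta h_0; the conventions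
   lead (-1) = lead (n+1) = 1 make the formula uniform. *)
Definition factor m : fps K :=
  (if m is j.+1 then lead j else 1) / (if (m <= n)%N then lead m else 1).

Lemma factor1 m : (m <= n.+1)%N -> fcoef (factor m) 0 = 1.
Proof.
move=> lem; rewrite fcoef0M.
have -> : fcoef (if m is j.+1 then lead j else 1) 0 = 1.
  by case: m lem => // m lem; rewrite lead1.
by rewrite mul1r fcoef0V //; case: ifP => // /lead1.
Qed.

Lemma act_ebas m f : (m <= n)%N ->
  act (ebas m) f%:P = (theta_chain factor m f)%:P.
Proof.
elim: m => [_|m IH ltmn]; rewrite /ebas actZ.
  by rewrite act_ell0 -polyCM /= /factor /= mul1r.
rewrite act_ellS ?lead_unit 1?ltnW // ell_coord /= 1?ltnW // gtn_eqF //.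
rewrite mul0r subr0 -actZ IH 1?ltnW // thetaPC -!polyCM /=.
by rewrite /factor ltmn mulrCA mulrA.
Qed.

(** Read [ell n.+1 = 0] as the operator identity L = f_n theta f_n^-1 L_n. *)
Lemma Lfps_chain f : Lfps n.+1 a f = theta_chain factor n.+1 f.
Proof.
have := act_ellS f%:P (lead_unit (leqnn n)).
rewrite ell_last /act big1 => [|i _]; last by rewrite mxE mul0r.
rewrite -/(act _ _) -actZ act_ebas // ell_coord //= eqxx mul1r LP_polyC.
move/esym/eqP; rewrite subr_eq0 thetaPC -polyCM => /eqP/polyC_inj <-.
by rewrite /factor ltnn invr1 mulr1.
Qed.

(** Taking adjoints reverses the factors and gives a sign for each theta. Below the top order no
    reduction modulo L occurs, so the [Lstar] term is evaluated at 0. *)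
Lemma adjoint_ebas m f : (m <= n)%N -> adjoint (ebas m) f =
  (-1) ^+ m * theta_chain (fun j => factor (m - j)) m f.
Proof.
elim: m f => [|m IH] f lemn.
  rewrite mul1r /= /factor /= mul1r /adjoint big_ord_recl big1 => [|i _].
    by rewrite ebas_coord // mul1r addr0.
  by rewrite ebas_coord // mul0r raddf0 mulr0.
have -> : ebas m.+1 = factor m.+1 *: thetaLam (ebas m).
  rewrite theta_ebas // scalerA /factor lemn mulrA mulrVK ?lead_unit //.
  by rewrite mulrV ?lead_unit 1?ltnW // scale1r.
rewrite theta_chainSr subn0 adjointZ adjoint_thetaLam ebas_coord 1?ltnW //= gtn_eqF //.
rewrite IH 1?ltnW // exprS mulN1r mulNr.
suff -> : Lstar n.+1 a (0 * (factor m.+1 * f)) = 0 by rewrite subr0.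
rewrite mul0r /Lstar raddf0 mulr0 add0r big1 // => i _.
by rewrite mulr0 raddf0 mulr0.
Qed.

(** Since [ebas n] is horizontal, [adjoint_thetaLam] expresses L^* through the adjoint of [ebas n];
    the argument [lead n * f] cancels its leading coordinate. *)
Lemma Lstar_chain f : Lstar n.+1 a f =
  (-1) ^+ n.+1 * theta_chain (fun j => factor (n.+1 - j)) n.+1 f.
Proof.
have := adjoint_thetaLam a (ebas n) (lead n * f).
rewrite theta_ebas_last /adjoint big1 => [|i _]; last by rewrite mxE mul0r raddf0 mulr0.
rewrite -/(adjoint _ _) ebas_coord // eqxx mulKr ?lead_unit // => /esym/eqP.
rewrite subr_eq0 => /eqP <-; rewrite adjoint_ebas // theta_chainSr subn0 exprS mulN1r mulNr.
by rewrite /factor ltnn invr1 mulr1.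
Qed.

(** * Duality of the factors under self-adjointness *)

Section SelfAdjoint.
Variable beta : fps K.
Hypotheses (sa : self_adjoint n.+1 a beta) (beta1 : fcoef beta 0 = 1).

Lemma lead_duality i : (i <= n)%N -> beta * lead i * lead (n - i) = 1.
Proof.
have bU := fps_unit beta1.
(* The factors of beta L beta^-1, in the shape given by [theta_chainMl] and [theta_chainMr];
   self-adjointness equates this chain with the reversed one. *)
pose h j := if j == n.+1 then beta * (if j == 0%N then factor j * beta^-1 else factor j)
  else (if j == 0%N then factor j * beta^-1 else factor j).
have chainE : theta_chain h n.+1 =1 theta_chain (fun j => factor (n.+1 - j)) n.+1.
  move=> f; rewrite /h -theta_chainMl -theta_chainMr -Lfps_chain.
  have := sa f; rewrite Lstar_chain -mulrA => /(congr1 (fun g => (-1) ^+ n.+1 * g)).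
  by rewrite !signrMK.
have hE j : (j <= n.+1)%N -> h j = factor (n.+1 - j).
  apply: (theta_chain_inj charK0 _ _ chainE) => {}j lej.
    have E : fcoef (if j == 0%N then factor j * beta^-1 else factor j) 0 = 1.
      by case: ifP => _; [rewrite fcoef0M factor1 // fcoef0V // mul1r | exact: factor1].
    by rewrite /h; case: ifP => _; [rewrite fcoef0M E beta1 mul1r | exact: E].
  by rewrite factor1 // leq_subr.
(* The innermost factors give the case i = 0. The next ones give f_i f_(n-i) = f_(i+1) f_(n-i-1), so
   the product does not depend on i. *)
elim: i => [_|i IH ltin].
  rewrite subn0; have := hE 0%N isT; rewrite /h /= /factor ltnn /= mul1r invr1 mulr1 => <-.
  by rewrite mulrA mulrK ?lead_unit // mulrV.
have := hE i.+1; rewrite ltnS ltnW // => /(_ isT).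
rewrite /h eqSS ltn_eqF //= subSS /factor ltin leq_subr.
rewrite -(subnSK ltin) => E.
rewrite -(IH (ltnW ltin)) -(subnSK ltin) -!mulrA; congr (_ * _).
move/(congr1 (fun f => f * lead i.+1 * lead (n - i.+1).+1)): E.
rewrite mulrVK ?lead_unit // => ->.
by rewrite mulrAC mulrVK ?lead_unit 1?mulrC // subnSK // leq_subr.
Qed.

End SelfAdjoint.
End Factorization.

(** * The flag *)

Section Flag.
Variables (K : fieldType) (charK0 : [pchar K] =i pred0).
Variables (n : nat) (a : nat -> fps K).
Implicit Types (f g : fps K) (v w x y : Lam K n.+1).
Local Notation theta := (@fps_theta K).
Local Notation thetaLam := (@thetaLam K n.+1 a).
Local Notation Fil := (@Fil K n.+1).

Lemma thetaLam0 : thetaLam 0 = 0.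
Proof. by rewrite -(scale0r 0) thetaLamZ raddf0 !scale0r addr0. Qed.

Lemma thetaLam_sum m (c : 'I_m -> Lam K n.+1) :
  thetaLam (\sum_j c j) = \sum_j thetaLam (c j).
Proof. exact: (big_morph _ (@thetaLamD K n a) thetaLam0). Qed.

Lemma FilB i x y : Fil i x -> Fil i y -> Fil i (x - y).
Proof. by move=> Fx Fy j lej; rewrite !mxE Fx ?Fy ?subr0. Qed.

Lemma FilZ i f x : Fil i x -> Fil i (f *: x).
Proof. by move=> Fx j lej; rewrite mxE Fx ?mulr0. Qed.

(** Griffiths transversality: the coordinate on eta^(n) is zero, so theta raises the order by at
    most one. *)
Lemma Fil_theta i x : (i <= n)%N -> Fil i.+1 x -> Fil i (thetaLam x).
Proof.
move=> lein Fx j lej; rewrite thetaLamE Fx ?raddf0 ?add0r; last by lia.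
rewrite (Fx ord_max) ?mul0r ?subr0; last by rewrite /=; lia.
by case: ifP => // j_gt0; have ltj := ltn_ord j; rewrite Fx // inordK; lia.
Qed.

Lemma Fil_last x : Fil n.+1 x -> x = 0.
Proof. by move=> Fx; apply/rowP => j; rewrite mxE Fx // leq_addl. Qed.

Variables (u : nat -> Lam K n.+1) (tau : nat -> fps K).
Hypothesis u_Fil : forall i, (i <= n)%N -> Fil i (u i).
Hypothesis u_unit : forall i, (i <= n)%N -> u i 0 (inord (n - i)) \is a GRing.unit.
Hypothesis theta_u0 : thetaLam (u 0) = 0.
Hypothesis theta_uS : forall i, (i < n)%N -> thetaLam (u i.+1) = tau i *: u i.
Hypothesis tau1 : forall i, fcoef (tau i) 0 = 1.

Definition flag i x : Prop :=
  exists c : nat -> fps K, x = \sum_(j < i.+1) c j *: u j.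

(** Triangularity: on eta^(n-j) the terms beyond j vanish by [u_Fil] and those before j by
    induction, leaving c_j times a unit. *)
Lemma flag_free m i (c : nat -> fps K) : (m <= n.+1)%N -> (i <= n)%N ->
  Fil i.+1 (\sum_(j < m) c j *: u j) ->
  forall j, (j <= i)%N -> (j < m)%N -> c j = 0.
Proof.
move=> lem lein FS j; elim/ltn_ind: j => j IH leji ltjm.
have lejn : (j <= n)%N by lia.
have := FS (inord (n - j)); rewrite inordK; last by lia.
move=> /(_ ltac:(lia)); rewrite summxE (bigD1 (Ordinal ltjm)) //= mxE big1 ?addr0.
  by move/(canRL (mulrK (u_unit lejn))); rewrite mul0r.
move=> l; rewrite -val_eqE /= neq_ltn => /orP[ltlj|ltjl].
  by rewrite IH ?scale0r ?mxE //; lia.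
have lelm := ltn_ord l.
by rewrite mxE u_Fil ?mulr0 ?inordK //; lia.
Qed.

(** Elimination from the top coordinate down: [d] clears the coordinate on eta^(n-i). At i = n+1
    nothing is left, so the u_j span Lambda. *)
Lemma flag_span i v : (i <= n.+1)%N ->
  exists c : nat -> fps K, Fil i (v - \sum_(j < i) c j *: u j).
Proof.
elim: i => [_|i IH lti].
  by exists (fun=> 0) => j; have := ltn_ord j; lia.
have [|c Fc] := IH; first by lia.
have lein : (i <= n)%N by lia.
have [w wE] : exists w, w = v - \sum_(j < i) c j *: u j by eexists.
rewrite -wE in Fc; pose d := w 0 (inord (n - i)) / u i 0 (inord (n - i)).
exists (fun j => if j == i then d else c j).
rewrite big_ord_recr /= eqxx (eq_bigr (fun j : 'I_i => c j *: u j)); last first.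
  by move=> j _; rewrite ltn_eqF.
rewrite opprD addrA -wE => j lej; rewrite !mxE.
have [lt|le] := ltnP n (j + i).
  by rewrite Fc // u_Fil // mulr0 subr0.
have -> : j = inord (n - i) by apply/val_inj; rewrite /= inordK; lia.
by rewrite mulrVK ?u_unit // subrr.
Qed.

Lemma flag0 i : flag i 0.
Proof. by exists (fun=> 0); rewrite big1 // => j _; rewrite scale0r. Qed.

Lemma flagD i x y : flag i x -> flag i y -> flag i (x + y).
Proof.
move=> [c ->] [d ->]; exists (fun j => c j + d j).
by rewrite -big_split; apply: eq_bigr => j _; rewrite scalerDl.
Qed.

Lemma flagZ i f x : flag i x -> flag i (f *: x).
Proof.
move=> [c ->]; exists (fun j => f * c j).
by rewrite scaler_sumr; apply: eq_bigr => j _; rewrite scalerA.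
Qed.

Lemma flag_sum i m (x : 'I_m -> Lam K n.+1) :
  (forall j, flag i (x j)) -> flag i (\sum_j x j).
Proof.
by move=> fx; apply: (big_ind (flag i)) => //; [apply: flag0 | apply: flagD].
Qed.

Lemma flag_u i j : (j <= i)%N -> flag i (u j).
Proof.
move=> leji; exists (fun l => (l == j)%:R).
rewrite (bigD1 (Ordinal (leji : j < i.+1)%N)) //= eqxx scale1r big1 ?addr0 // => l.
by rewrite -val_eqE /= => /negPf ->; rewrite scale0r.
Qed.

Lemma flag_submodule i : (i <= n)%N -> submoduleD a (flag i).
Proof.
move=> lein; split; [exact: flag0 | exact: flagD | exact: flagZ |].
move=> _ [c ->]; rewrite thetaLam_sum; apply: flag_sum => j.
have ltj := ltn_ord j.
rewrite thetaLamZ; apply: flagD; apply: flagZ; first by apply: flag_u.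
case: (nat_of_ord j) ltj => [|k] ltk; first by rewrite theta_u0; apply: flag0.
by rewrite theta_uS; [apply/flagZ/flag_u|]; lia.
Qed.

Lemma flag_direct i : (i <= n)%N -> direct_sum (flag i) (Fil i.+1).
Proof.
move=> lein; split=> [v|_ [c ->] FS].
  have [|c Fc] := @flag_span i.+1 v; first by lia.
  exists (\sum_(j < i.+1) c j *: u j), (v - \sum_(j < i.+1) c j *: u j).
  by split=> //; [exists c | rewrite addrC subrK].
rewrite big1 // => j _; have ltj := ltn_ord j.
by rewrite (flag_free _ lein FS) ?scale0r //; lia.
Qed.

Lemma flag_good : good_filtration a (fun i => flag i).
Proof.
split=> [i|i lti _ [c ->]|i|i lti]; first exact: flag_submodule.
- apply: flag_sum => j; apply/flagZ/flag_u; have := ltn_ord j; lia.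
- exact: flag_direct.
(* The quotient has rank one, generated by the class of [u i.+1], which is horizontal modulo
   [flag i]. *)
exists 1%N, (fun=> u i.+1); split=> [_|_ [c ->]|c].
- split; first exact: flag_u.
  by rewrite theta_uS; [apply/flagZ/flag_u | lia].
- exists (fun=> c i.+1); rewrite [X in _ - X]big_ord1 big_ord_recr addrK.
  by exists c.
rewrite big_ord1 => fc j; rewrite (ord1 j).
have lein : (i <= n)%N by lia.
have /(_ _ fc (FilZ _ (u_Fil _))) := (flag_direct lein).2 => /(_ lti).
move/(congr1 (fun v : Lam K n.+1 => v 0 (inord (n - i.+1)))); rewrite !mxE.
by move/(canRL (mulrK (u_unit (lti : i.+1 <= n)%N))); rewrite mul0r.
Qed.

(* Reducing modulo t, nilpotency of the system forces g and all the c j to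
   vanish at 0; then each c j solves theta c = g c. *)
Lemma nilpotent_system_eq0 (c : nat -> fps K) g i :
  (forall j, (n < j)%N -> c j = 0) -> tau i * c i.+1 = g ->
  (forall j, (i < j)%N -> theta (c j) + tau j * c j.+1 = g * c j) ->
  forall j, (i < j)%N -> c j = 0.
Proof.
move=> c_big gE cE.
have ev j : (i < j)%N -> fcoef (c j.+1) 0 = fcoef g 0 * fcoef (c j) 0.
  move=> /cE /(congr1 (fun f => fcoef f 0)).
  by rewrite fcoefD fcoef_theta0 add0r !fcoef0M tau1 mul1r.
have g0E : fcoef g 0 = fcoef (c i.+1) 0 by rewrite -gE fcoef0M tau1 mul1r.
have g0 : fcoef g 0 = 0.
  apply: contrapT => /eqP g0.
  have H k j : (i < j)%N -> (n < j + k)%N -> fcoef (c j) 0 = 0.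
    elim: k j => [|k IH] j ltij ltj; first by rewrite c_big //; lia.
    have /eqP := ev j ltij; rewrite IH; [|lia|lia].
    by rewrite eq_sym mulf_eq0 (negPf g0) => /eqP.
  by move/eqP: g0; apply; rewrite g0E (H n i.+1) //; lia.
have c0 j : (i < j)%N -> fcoef (c j) 0 = 0.
  elim: j => // j IH; rewrite ltnS leq_eqVlt => /orP[/eqP <-|ltij].
    by rewrite -g0E.
  by rewrite ev // g0 mul0r.
have H k j : (i < j)%N -> (n < j + k)%N -> c j = 0.
  elim: k j => [|k IH] j ltij ltj; first by rewrite c_big //; lia.
  apply: (theta_eq_mul0 charK0 g0 (c0 j ltij)).
  by rewrite -(cE j ltij) (IH j.+1) ?mulr0 ?addr0 //; lia.
by move=> j ltij; apply: (H n) => //; lia.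
Qed.

(** It suffices that u_i lies in U_i. By [step] this follows once theta u_i does, which holds by
    induction as theta u_i is a multiple of u_(i-1), or 0. *)
Lemma flag_unique (U : nat -> Lam K n.+1 -> Prop) : good_filtration a U ->
  forall i, (i <= n)%N -> forall x, U i x <-> flag i x.
Proof.
move=> [Usub Uinc Udir _].
have Ule i j x : (i <= j)%N -> (j <= n)%N -> U i x -> U j x.
  move=> leij lejn Uix; elim: j leij lejn => [|j IH] leij lejn.
    by move: leij Uix; rewrite leqn0 => /eqP ->.
  move: leij; rewrite leq_eqVlt => /orP[/eqP <- //|ltij].
  by apply: Uinc; [lia | apply: IH; lia].
have U_B i x y : (i <= n)%N -> U i x -> U i y -> U i (x - y).
  move=> lein Ux Uy; have [_ UD UZ _] := Usub i lein.
  by apply: UD => //; rewrite -scaleN1r; apply: UZ.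
have step i : (i <= n)%N -> U i (thetaLam (u i)) -> U i (u i).
  move=> lein Uth; have [_ _ UZ UT] := Usub i lein; have [dec Uz] := Udir i lein.
  (* Correct u_i by some z in Fil^(i+1) to land in U_i; the aim is z = 0. *)
  have [x [y [Ux Fy uE]]] := dec (u i); have [z zdef] : exists z, z = x - u i by eexists.
  have Fz : Fil i.+1 z.
    by rewrite zdef uE opprD addrA subrr add0r -scaleN1r; apply: FilZ.
  have xE : x = u i + z by rewrite zdef addrC subrK.
  have Fth := Fil_theta lein Fz.
  (* By transversality theta z lies in Fil^i. This [d] cancels its top coordinate, so theta z - d
     (u_i + z) lies in both U_i and Fil^(i+1), hence is 0. *)
  pose d := thetaLam z 0 (inord (n - i)) / u i 0 (inord (n - i)).
  have thz : thetaLam z = d *: (u i + z).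
    apply/eqP; rewrite -subr_eq0; apply/eqP/Uz => [|j lej].
      apply: (U_B _ _ _ lein) => //; last by rewrite -xE; apply: UZ.
      have -> : thetaLam z = thetaLam x - thetaLam (u i).
        by rewrite xE thetaLamD addrAC subrr add0r.
      by apply: (U_B _ _ _ lein) => //; apply: UT.
    rewrite !mxE (Fz j lej) addr0.
    have [lt|le] := ltnP n (j + i).
      by rewrite Fth // u_Fil // mulr0 subr0.
    have -> : j = inord (n - i) by apply/val_inj; rewrite /= inordK; lia.
    by rewrite mulrVK ?u_unit // subrr.
  have [c' /Fil_last/eqP] := flag_span z (leqnn n.+1); rewrite subr_eq0 => /eqP.
  (* Coefficients beyond n are set to 0 so that the system ends with the same formula. *)
  pose c j := if (j <= n)%N then c' j else 0.
  rewrite (eq_bigr (fun j : 'I_n.+1 => c j *: u j)) => [zE|j _]; last first.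
    by rewrite /c -ltnS ltn_ord.
  have c_big j : (n < j)%N -> c j = 0 by rewrite /c ltnNge => /negPf ->.
  have c_small j : (j <= i)%N -> c j = 0.
    move=> leji; apply: (@flag_free n.+1 i c _ lein) => //; last by lia.
    by rewrite -zE.
  have thzE : thetaLam z = \sum_(j < n.+1) (theta (c j) + tau j * c j.+1) *: u j.
    rewrite {1}zE thetaLam_sum; under eq_bigr => j _ do rewrite thetaLamZ.
    under [RHS]eq_bigr => j _ do rewrite scalerDl.
    rewrite !big_split /=; congr (_ + _).
    rewrite big_ord_recl theta_u0 scaler0 add0r big_ord_recr /= c_big // mulr0 scale0r addr0.
    by apply: eq_bigr => j _; rewrite /bump add1n theta_uS // scalerA mulrC.
  have eqc j : (j <= n)%N ->
      theta (c j) + tau j * c j.+1 = d * ((j == i)%:R + c j).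
    move=> lejn; apply/eqP; rewrite -subr_eq0; apply/eqP.
    pose C j := theta (c j) + tau j * c j.+1 - d * ((j == i)%:R + c j).
    suff C0 : \sum_(j < n.+1) C j *: u j = 0.
      by apply: (@flag_free n.+1 n C) => //; rewrite C0 => l _; rewrite mxE.
    under eq_bigr => k _ do rewrite scalerBl.
    rewrite sumrB -thzE thz; apply/eqP; rewrite subr_eq0; apply/eqP.
    under [RHS]eq_bigr => k _ do rewrite -scalerA scalerDl.
    rewrite -scaler_sumr big_split /= -zE; congr (_ *: (_ + _)).
    rewrite (bigD1 (Ordinal (lein : i < n.+1)%N)) //= eqxx scale1r big1 ?addr0 // => k.
    by rewrite -val_eqE /= => /negPf ->; rewrite scale0r.
  have z0 : z = 0.
    rewrite zE big1 // => j _; have [/c_small ->|ltij] := leqP j i; rewrite ?scale0r //.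
    (* The equation at index i reads tau_i c_(i+1) = d, since c_i = 0; those above i are
       homogeneous. *)
    rewrite (@nilpotent_system_eq0 c d i) ?scale0r // => [|k ltik].
      by have := eqc i lein; rewrite eqxx c_small // raddf0 add0r addr0 mulr1.
    have [lekn|ltnk] := leqP k n; first by rewrite eqc // gtn_eqF // add0r.
    by rewrite !c_big ?raddf0 ?mulr0 ?addr0 // ltnW.
  by rewrite xE z0 addr0 in Ux.
have Uu i : (i <= n)%N -> U i (u i).
  elim: i => [|i IH] lein; apply: step => //.
    by rewrite theta_u0; have [] := Usub 0%N lein.
  have [_ _ UZ _] := Usub i.+1 lein.
  by rewrite theta_uS //; apply: UZ; apply: Uinc => //; apply: IH; lia.
move=> i lein; have [U0 UD UZ _] := Usub i lein.
have flagU x : flag i x -> U i x.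
  move=> [c ->]; apply: (big_ind (U i)) => // j _; apply: UZ.
  have ltj := ltn_ord j.
  by apply: (Ule j) => //; apply: Uu; lia.
move=> x; split=> [Ux|/flagU //].
have [[dec _] [_ Uz]] := (flag_direct lein, Udir i lein).
have [y [z [Fy Fz xE]]] := dec x.
have z0 : z = 0.
  apply: Uz => //; rewrite -(addKr y z) -xE addrC.
  by apply: (U_B _ _ _ lein) => //; apply: flagU.
by rewrite xE z0 addr0.
Qed.

End Flag.

(** * From the factorisation to the filtration and the Wronskian formulas *)

Lemma coord_inord (K : fieldType) (n : nat) (v : Lam K n.+1) j :
  (j <= n)%N -> Defs.coord v j = v 0 (inord j).
Proof.
move=> lejn; rewrite /Defs.coord insubT; congr (v 0 _).
by apply/val_inj; rewrite /= inordK.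
Qed.

Unset Implicit Arguments.
Set Strict Implicit.
Set Printing Implicit Defensive.

Theorem theorem1p4 (K : fieldType) (charK0 : [pchar K] =i pred0)
  (n : nat) (n_gt0 : (0 < n)%N) (a : nat -> fps K) (beta F : fps K)
  (Fr : nat -> {poly fps K}) :
  calabi_yau n a beta -> fcoef beta 0 = 1 -> frobenius n a F Fr ->
  exists U : nat -> Lam K n -> Prop,
    [/\ good_filtration a U,
        (forall U' : nat -> Lam K n -> Prop, good_filtration a U' ->
           forall i, (i < n)%N -> forall x, U' i x <-> U i x) &
        exists u : nat -> Lam K n,
          [/\ generates U u, normalized beta Fr u,
              (forall u' : nat -> Lam K n, generates U u' -> normalized beta Fr u' ->
                 exists c : nat -> K, forall i, (i < n)%N -> u' i = cst (c i) *: u i),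
              (forall i, (i.+1 < n)%N ->
                 exists tau : fps K,
                   tau%:P = qdiv (wrm1 Fr i * wr Fr i.+1) (wr Fr i ^+ 2)
                   /\ thetaLam a (u i.+1) = tau *: u i) &
              ((1 < n)%N ->
                 qdiv (wrm1 Fr 0 * wr Fr 1) (wr Fr 0 ^+ 2) = dlogq Fr)]].
Proof.
(* From here on the order is [n.+1] and the indices run from 0 to [n]. *)
case: n n_gt0 => // n _ [_ [_ sa]] beta1 frobF.
pose l := lead n a Fr.
have lU i : (i <= n)%N -> l i \is a GRing.unit by exact: (lead_unit charK0 frobF).
have l1 i : (i <= n)%N -> fcoef (l i) 0 = 1 by exact: (lead1 charK0 frobF).
have dual i : (i <= n)%N -> beta * l i * l (n - i)%N = 1.
  exact: (lead_duality charK0 frobF sa beta1).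
have wrl i : (i <= n)%N -> wr Fr i = (\prod_(j < i.+1) l j)%:P.
  exact: (wrE charK0 frobF).
have wrm1l i : (i <= n)%N -> wrm1 Fr i = (\prod_(j < i) l j)%:P.
  by case: i => [_|i ltin]; rewrite /= ?big_ord0 // wrl // ltnW.
have prodU i : (i <= n.+1)%N -> \prod_(j < i) l j \is a GRing.unit.
  by move=> lei; apply: rpred_prod => j _; apply: lU; have := ltn_ord j; lia.
have ratio i : (i <= n)%N -> qdiv (wr Fr i) (wrm1 Fr i) = (l i)%:P.
  move=> lein; rewrite wrl // wrm1l //; apply: qdivPC; first by apply: prodU; lia.
  by rewrite big_ord_recr /= mulrC polyCM.
have tauE i : (i < n)%N ->
    qdiv (wrm1 Fr i * wr Fr i.+1) (wr Fr i ^+ 2) = (l i.+1 / l i)%:P.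
  move=> ltin; have lein := ltnW ltin; rewrite !wrl // wrm1l // -rmorphXn.
  apply: qdivPC; first by rewrite unitrX // prodU.
  rewrite -!polyCM; congr (_%:P); rewrite !big_ord_recr /=.
  set P := \prod_(j < i) _.
  have -> : l i.+1 / l i * (P * l i) ^+ 2 = l i / l i * (P * (P * l i * l i.+1)) by ring.
  by rewrite mulrV ?lU // mul1r.
pose u i : Lam K n.+1 := ebas n a Fr (n - i).
pose tau i := l (n - i)%N / l (n - i.+1)%N.
have u_coord i (j : 'I_n.+1) : (i <= n)%N -> (n - i <= j)%N ->
    u i 0 j = if j == (n - i)%N :> nat then (l (n - i)%N)^-1 else 0.
  by move=> lein lej; rewrite /u (ebas_coord charK0 frobF) // leq_subr.
have u_Fil i : (i <= n)%N -> Fil i (u i).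
  by move=> lein j lej; rewrite u_coord ?gtn_eqF //; lia.
have u_lead i : (i <= n)%N -> u i 0 (inord (n - i)) = (l (n - i)%N)^-1.
  by move=> lein; rewrite u_coord ?inordK ?eqxx //; lia.
have u_unit i : (i <= n)%N -> u i 0 (inord (n - i)) \is a GRing.unit.
  by move=> lein; rewrite u_lead // unitrV lU // leq_subr.
have theta_u0 : thetaLam a (u 0%N) = 0.
  by rewrite /u subn0 (theta_ebas_last charK0 frobF).
have theta_uS i : (i < n)%N -> thetaLam a (u i.+1) = tau i *: u i.
  move=> ltin; rewrite /u (theta_ebas charK0 frobF); last by lia.
  by rewrite /tau subnSK.
have tau1 i : fcoef (tau i) 0 = 1.
  by rewrite fcoef0M fcoef0V ?l1 ?mulr1 // leq_subr.
have gen : generates (flag u) u.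
  move=> i lti x; split=> [[c ->]|[c ->]]; first by exists (fun j => c j).
  by exists (fun j => c (inord j)); apply: eq_bigr => j _; rewrite inord_val.
have nrm : normalized beta Fr u.
  move=> i lti; split; first exact: u_Fil.
  (* Duality turns the leading coordinate f_(n-i)^-1 into beta f_i, and f_i = wr_i / wr_(i-1). *)
  rewrite coord_inord ?leq_subr // u_lead // ratio // -polyCM; congr (_%:P).
  have lU' : l (n - i)%N \is a GRing.unit by rewrite lU // leq_subr.
  by rewrite -[RHS](mulrK lU') dual // mul1r.
exists (flag u); split; first exact: (flag_good u_Fil u_unit theta_u0 theta_uS).
  move=> U' goodU'; exact: (flag_unique charK0 u_Fil u_unit theta_u0 theta_uS tau1 goodU').
exists u; split=> //.
(* The normalisation fixes the leading coordinate exactly, so every constant is 1: u'_i - u_i lies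
   in U_i and in Fil^(i+1). *)
- move=> u' gen' nrm'; exists (fun=> 1) => i lti.
  have -> : cst 1 = 1 :> fps K by apply: fpsP => k /=; case: eqP.
  rewrite scale1r; apply/eqP; rewrite -subr_eq0; apply/eqP.
  have [Fu' cu'] := nrm' i lti; have [Fu cu] := nrm i lti.
  have [_ inj] := flag_direct u_Fil u_unit (lti : i <= n)%N; apply: inj.
    rewrite -scaleN1r; apply: flagD; last by apply/flagZ/flag_u.
    apply/(gen' i lti); exists (fun j => (j == ord_max)%:R).
    rewrite big_ord_recr /= eqxx scale1r big1 ?add0r // => j _.
    by rewrite -val_eqE /= ltn_eqF // scale0r.
  move=> j lej; have [lt|le] := ltnP n (j + i).
    exact: (FilB Fu' Fu).
  have -> : j = inord (n - i) by apply/val_inj; rewrite /= inordK; lia.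
  move: cu'; rewrite -cu => /polyC_inj; rewrite !coord_inord ?leq_subr // => E.
  by rewrite mxE [X in _ + X]mxE E subrr.
- move=> i lti; exists (tau i); rewrite theta_uS // tauE //; split=> //.
  congr (_%:P); have lein : (i <= n)%N by lia.
  (* Duality at i and i+1 gives f_(n-i) / f_(n-i-1) = f_(i+1) / f_i. *)
  have := dual i.+1 lti; rewrite -(dual i lein) -!mulrA.
  have bU := fps_unit beta1; move/(congr1 (fun f => beta^-1 * f)); rewrite !mulKr // => E.
  have [U1 U2] : l i \is a GRing.unit /\ l (n - i.+1)%N \is a GRing.unit.
    by split; apply: lU; lia.
  apply: (mulrI U1); apply: (mulIr U2); rewrite /tau.
  by rewrite -!mulrA mulVr // mulr1 -E mulrCA mulVKr.
move=> lt1n; rewrite tauE //.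
have [_ _ Fr0 _] := frobF.
have l0F : l 0%N = F by exact: (lead0 frobF).
have FU : F \is a GRing.unit by rewrite -l0F lU.
have -> : dlogq Fr = thetaP ((F^-1)%:P * Fr 1%N).
  congr thetaP; rewrite Fr0; apply: qdivE.
    by exists (F^-1)%:P; rewrite -polyCM mulVr.
  by rewrite mulrAC -polyCM mulVr // mul1r.
(* Here f_1 = L_1 F_1 = F theta (F_1 / F), so (log q)' = f_1 / f_0. *)
have := act_ell_lead charK0 frobF (lt1n : 1 <= n)%N.
have -> : act (ell n a Fr 1) (Fr 1%N) = F%:P * thetaP ((F^-1)%:P * Fr 1%N).
  rewrite act_ellS ?lU // (LP_Fr frobF) // mulr0 subr0 act_ell0.
  by rewrite -/l l0F.
by rewrite -/l => E; rewrite l0F mulrC polyCM -E mulrA -polyCM mulVr // mul1r.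
Qed.
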